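(* Let $K$ be a field of characteristic zero, $R=K[x_1,\ldots,x_n]$, and let $k$ be an integer with $1\le k\le n$. Let $h=(1,n,h_2,h_3,\ldots,h_c)$ be an O-sequence. The following three conditions are equivalent: (i) $h$ is the Hilbert function of some graded Artinian $K$-algebra with the $k$-SLP; (ii) $h$ is the Hilbert function of some graded Artinian $K$-algebra with the $k$-WLP; (iii) $h$ is a unimodal O-sequence, $\Delta^th$ is a unimodal O-sequence for every integer $t$ with $1\le t<k$, and $\Delta^kh$ is an O-sequence.
   Context: Graded $K$-algebras are standard graded: quotients of a polynomial ring over $K$ (variables in degree 1) by a homogeneous ideal; Artinian means finite-dimensional over $K$. The Hilbert function of $A=\bigoplus_iA_i$ is $t\mapsto\dim_KA_t$, identified with a finite sequence $(h_0,\ldots,h_c)$ of positive integers (trailing zeros omitted, $h_j=0$ for $j>c$ and $j<0$). An O-sequence is a sequence that is the Hilbert function of some graded $K$-algebra. SLP/WLP: for $\ell\in A_1$, $(A,\ell)$ has the SLP (resp. WLP) if the map $\times\ell^s:A_i\to A_{i+s}$ has full rank (is injective or surjective) for every $i\ge0$ and every $s>0$ (resp. for $s=1$). $A$ has the $k$-SLP (resp. $k$-WLP) if there are $g_1,\ldots,g_k\in A_1$ such that $(A,g_1)$ has the SLP (resp. WLP) and $(A/(g_1,\ldots,g_{i-1}),g_i)$ has the SLP (resp. WLP) for all $i=2,\ldots,k$. Difference: $(\Delta h)_i=\max\{h_i-h_{i-1},0\}$ for $i\ge0$ with $h_{-1}=0$; $\Delta^t$ is $\Delta$ applied $t$ times.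 Unimodal: there is $i\ge0$ such that $h_0<h_1<\cdots<h_i$ and $h_i\ge h_{i+1}\ge\cdots$. *)

(* Defs.v *)
From mathcomp Require Import all_boot all_order all_algebra.
From mathcomp Require Export mpoly.

Set Implicit Arguments.
Unset Strict Implicit.
Unset Printing Implicit Defensive.

Import GRing.Theory.
Local Open Scope ring_scope.

(* A standard graded K-algebra A is presented as {mpoly K[m]} / I, with m      *)
(* arbitrary and I a homogeneous ideal given as a Prop-valued predicate.  An   *)
(* element of A is represented by a polynomial, equality in A is [eqmod I],    *)
(* and A_t consists of the classes of the homogeneous polynomials of degree t. *)

Section GradedAlgebra.
Variables (K : fieldType) (m : nat).
Implicit Types (I : {mpoly K[m]} -> Prop) (f g l : {mpoly K[m]}).

Definition homogeneous_ideal I : Prop :=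
  [/\ I 0,
      forall f g, I f -> I g -> I (f + g),
      forall f g, I g -> I (f * g)
    & forall f t, I f -> I (pihomog mdeg t f)].

Definition eqmod I f g : Prop := I (f - g).

Definition artinian I : Prop :=
  exists (d : nat) (b : 'I_d -> {mpoly K[m]}),
    forall f, exists a : 'I_d -> K, eqmod I f (\sum_(j < d) a j *: b j).

(* dim_K A_t = d: A_t has a basis of d elements. *)
Definition graded_dim I (t d : nat) : Prop :=
  exists b : 'I_d -> {mpoly K[m]},
    (forall j, b j \is t.-homog) /\
    (forall f, f \is t.-homog ->
       exists! a : {ffun 'I_d -> K}, eqmod I f (\sum_(j < d) a j *: b j)).

Definition hilbert_function I (h : nat -> nat) : Prop :=
  forall t : nat, graded_dim I t (h t).

(* The multiplication map by l ^+ s from A_i to A_(i + s), for l in A_1. *)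
Definition mul_injective I l (s i : nat) : Prop :=
  forall f g, f \is i.-homog -> g \is i.-homog ->
    eqmod I (l ^+ s * f) (l ^+ s * g) -> eqmod I f g.

Definition mul_surjective I l (s i : nat) : Prop :=
  forall g, g \is (i + s).-homog ->
    exists2 f, f \is i.-homog & eqmod I (l ^+ s * f) g.

Definition full_rank I l (s i : nat) : Prop :=
  mul_injective I l s i \/ mul_surjective I l s i.

Definition SLP I l : Prop :=
  l \is 1.-homog /\ forall i s : nat, (0 < s)%N -> full_rank I l s i.

Definition WLP I l : Prop :=
  l \is 1.-homog /\ forall i : nat, full_rank I l 1 i.

(* The ideal I + (gs), so that its quotient is A / (gs). *)
Definition add_gens I (gs : seq {mpoly K[m]}) : {mpoly K[m]} -> Prop :=
  fun f => exists a : 'I_(size gs) -> {mpoly K[m]},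
    eqmod I f (\sum_(j < size gs) a j * gs`_j).

(* With 0-based indices, the i-th condition is about A / (g_0, .., g_(i-1)),   *)
(* which is A itself for i = 0.                                                *)
Definition kSLP (k : nat) I : Prop :=
  exists g : k.-tuple {mpoly K[m]},
    forall i : 'I_k, SLP (add_gens I (take i g)) (tnth g i).

Definition kWLP (k : nat) I : Prop :=
  exists g : k.-tuple {mpoly K[m]},
    forall i : 'I_k, WLP (add_gens I (take i g)) (tnth g i).

End GradedAlgebra.

Definition O_sequence (K : fieldType) (h : nat -> nat) : Prop :=
  exists (m : nat) (I : {mpoly K[m]} -> Prop),
    homogeneous_ideal I /\ hilbert_function I h.

(* The subtraction of natural numbers is truncated, which gives the            *)
(* max{h_i - h_(i-1), 0} of the definition; h_(-1) = 0.                        *)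
Definition delta (h : nat -> nat) : nat -> nat :=
  fun i => if i is j.+1 then (h j.+1 - h j)%N else h 0%N.

Definition unimodal (h : nat -> nat) : Prop :=
  exists i : nat,
    (forall j : nat, (j < i)%N -> (h j < h j.+1)%N) /\
    (forall j : nat, (i <= j)%N -> (h j.+1 <= h j)%N).

(* Main.v *)
(* A linear form with the WLP on A cuts the Hilbert function h down to delta h, and
   delta h stays 0 once it vanishes; hence h is unimodal, and iterating along the
   k linear forms gives (iii).

   Conversely, start from an algebra with Hilbert function delta^k h and adjoin k
   variables one at a time, going from delta^(t+1) h to delta^t h.  One step turns
   an algebra B = K[m] / I with Hilbert function delta h, h unimodal with peak p,
   into a quotient A of B[z].  Order a homogeneous basis b_0, b_1, ... of B by
   increasing degree; it has h p elements, and those of degree at most t <= p are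
   the first h t.  Setting z = 1 sends (B[z])_t onto the part of B of degree at most t;
   let A_t be its quotient by the span of the b_j with j >= h t.  The kernel is
   an ideal because multiplication by a variable raises the degree.
   In these coordinates z ^ s : A_i -> A_(i + s) is truncation from h i to h (i + s)
   coordinates, so it has full rank, and A / (z) is B. *)

Require Import Defs.
From HB Require Import structures.
From mathcomp Require Import all_boot all_order all_algebra.
From mathcomp Require Import zify.
From Stdlib Require Import FunctionalExtensionality PropExtensionality.
From Stdlib Require Import ClassicalEpsilon.

Set Implicit Arguments.
Unset Strict Implicit.
Unset Printing Implicit Defensive.

Import GRing.Theory.
Local Open Scope ring_scope.

(** * Choice and extensionality for predicates *)

Lemma choice_fun (T : Type) (U : T -> Type) (P : forall x, U x -> Prop) :
  (forall x, exists y, P x y) -> exists f : forall x, U x, forall x, P x (f x).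
Proof.
move=> exP; exists (fun x => proj1_sig (constructive_indefinite_description _ (exP x))).
by move=> x; case: constructive_indefinite_description.
Qed.

Lemma pred_ext (T : Type) (P Q : T -> Prop) : (forall x, P x <-> Q x) -> P = Q.
Proof.
move=> eqPQ; apply: functional_extensionality => x.
exact: propositional_extensionality.
Qed.

(** * Homogeneous components *)

Section Homogeneous.
Variables (K : fieldType) (m : nat).
Implicit Types (f g l : {mpoly K[m]}).

(** Monomials are products of variables, so identities between ring morphisms reduce to a check on
    the variables. *)
Lemma mpoly_ind_vars (P : {mpoly K[m]} -> Prop) :
  P 1 -> (forall c f g, P f -> P g -> P (c *: f + g)) ->
  (forall i f, P f -> P ('X_i * f)) -> forall f, P f.
Proof.
(* Zero is obtained as the combination [(-1) *: 1 + 1]. *)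
move=> P1 PD PX; have P0 : P 0 by rewrite -(subrr 1) addrC -scaleN1r; apply: PD.
have PXm : forall d (n : 'X_{1..m}), mdeg n = d -> P 'X_[n].
  elim=> [n /eqP|d IHd n n_d]; first by rewrite mdeg_eq0 => /eqP ->; rewrite mpolyX0.
  have [i ni|n0] := pickP (fun i => n i != 0%N); last first.
    suff -> : n = 0%MM by rewrite mpolyX0.
    by apply/mnmP=> i; rewrite mnm0E; apply/eqP; move/negbFE: (n0 i).
  have U_le : (U_(i) <= n)%MM by rewrite lep1mP.
  rewrite -(submK U_le) addmC mpolyXD; apply: PX; apply: IHd.
  have := congr1 (@mdeg m) (submK U_le); rewrite mdegD mdeg1 n_d; lia.
move=> f; rewrite (mpolyE f); elim/big_rec: _ => // n g _ Pg.
by apply: PD => //; apply: PXm erefl.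
Qed.

Lemma homog_monom n : ('X_[n] : {mpoly K[m]}) \is (mdeg n).-homog.
Proof. by rewrite dhomogX. Qed.

Lemma pihomogMl e l d g : l \is e.-homog ->
  pihomog mdeg (d + e) (l * g) = l * pihomog mdeg d g.
Proof.
move=> l_e; rewrite (mpolyE g); elim/big_rec: _ => [|n f _ IHf].
  by rewrite mulr0 !pihomog0 mulr0.
rewrite mulrDr -scalerAr !pihomogD !linearZ /= IHf mulrDr -scalerAr.
congr (_ *: _ + _); rewrite pihomogX; have := dhomogM l_e (homog_monom n).
case: eqP => [->|/eqP nd] ln_hom; first by rewrite pihomog_dE // addnC.
by rewrite mulr0 (pihomog_ne0 _ ln_hom) // addnC eqn_add2r.
Qed.

Lemma pihomogMl_lt e l d g : l \is e.-homog -> (d < e)%N ->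
  pihomog mdeg d (l * g) = 0.
Proof.
move=> l_e lt_de; rewrite (mpolyE g); elim/big_rec: _ => [|n f _ IHf].
  by rewrite mulr0 pihomog0.
have ln_hom := dhomogM l_e (homog_monom n).
rewrite mulrDr -scalerAr pihomogD linearZ /= IHf (pihomog_ne0 _ ln_hom) ?scaler0 ?addr0 //=.
by lia.
Qed.

Lemma pihomogMl1 l d g : l \is 1.-homog ->
  pihomog mdeg d.+1 (l * g) = l * pihomog mdeg d g.
Proof. by move=> l_1; rewrite -[d.+1]addn1 pihomogMl. Qed.

Lemma homogX1 (i : 'I_m) : ('X_i : {mpoly K[m]}) \is 1.-homog.
Proof. by rewrite dhomogX /= mdeg1. Qed.

Lemma homog_ind (P : nat -> {mpoly K[m]} -> Prop) :
  P 0%N 1 -> (forall t, P t 0) ->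
  (forall t c f g, P t f -> P t g -> P t (c *: f + g)) ->
  (forall t i f, P t f -> P t.+1 ('X_i * f)) ->
  forall t f, f \is t.-homog -> P t f.
Proof.
move=> P1 P0 PD PX t f f_t.
(* An ungraded induction works once the claim covers every component of every polynomial: a variable
   shifts components by one degree. *)
suff Pf : forall g s, P s (pihomog mdeg s g) by rewrite -(pihomog_dE f_t).
apply: mpoly_ind_vars => [s|c g1 g2 Pg1 Pg2 s|i g Pg s].
- case: s => [|s]; first by rewrite pihomog_dE // dhomog1.
  by rewrite (@pihomog_ne0 _ _ _ 0) // dhomog1.
- by rewrite linearP; apply: PD.
- case: s => [|s]; first by rewrite (pihomogMl_lt _ (homogX1 i)).
  by rewrite pihomogMl1 ?homogX1 //; apply: PX.
Qed.

End Homogeneous.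

(** * Homogeneous ideals and their Hilbert functions *)

Section Ideals.
Variables (K : fieldType) (m : nat).
Implicit Types (f g l : {mpoly K[m]}) (I : {mpoly K[m]} -> Prop).

Section IdealTheory.
Variable I : {mpoly K[m]} -> Prop.
Hypothesis homI : homogeneous_ideal I.

Lemma ideal0 : I 0. Proof. by case: homI. Qed.
Lemma idealD f g : I f -> I g -> I (f + g).
Proof. by case: homI => _ H _ _; apply: H. Qed.
Lemma idealMl f g : I g -> I (f * g).
Proof. by case: homI => _ _ H _; apply: H. Qed.
Lemma ideal_pihomog t f : I f -> I (pihomog mdeg t f).
Proof. by case: homI => _ _ _ H; apply: H. Qed.
Lemma idealZ c f : I f -> I (c *: f).
Proof. by move=> If; rewrite -mul_mpolyC; apply: idealMl. Qed.
Lemma ideal_sum (J : finType) (F : J -> {mpoly K[m]}) :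
  (forall j, I (F j)) -> I (\sum_j F j).
Proof.
by move=> IF; elim/big_rec: _ => [|j g _ Ig]; [exact: ideal0|exact: idealD].
Qed.

Lemma ideal_homog_comp f : (forall t, I (pihomog mdeg t f)) -> I f.
Proof.
by move=> If; rewrite (pihomog_partitionE (leqnn (mmeasure mdeg f))); apply: ideal_sum.
Qed.

(** Unique coordinates in a basis of $A_t$ amount to a linear map with kernel $I_t$ in degree [t]
    and full image. Later dimension counts build such a map, which gives access to matrix ranks. *)
Lemma graded_dim_coord t d : graded_dim I t d <->
  exists phi : {linear {mpoly K[m]} -> 'rV[K]_d},
    (forall f, f \is t.-homog -> I f <-> phi f = 0) /\
    (forall v, exists2 f, f \is t.-homog & phi f = v).
Proof.
split=> [[b [b_t coordP]]|[phi [kerP surjP]]].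
  (* Coordinates are read off the component of degree [t], which extends them linearly to all
     polynomials. *)
  have /choice_fun[a aP] f : exists a : {ffun 'I_d -> K},
      unique (fun a : {ffun _ -> _} => eqmod I (pihomog mdeg t f) (\sum_j a j *: b j)) a.
    exact: (coordP _ (pihomogP mdeg t f)).
  have a_eq f (e : 'I_d -> K) : f \is t.-homog ->
      eqmod I f (\sum_j e j *: b j) -> a f =1 e.
    move=> f_t fe j; have [_ /(_ (finfun e))] := aP f.
    rewrite pihomog_dE // => -> //; first by rewrite ffunE.
    by under eq_bigr do rewrite ffunE.
  have a_pi f : a (pihomog mdeg t f) =1 a f.
    by apply: a_eq; [exact: pihomogP|case: (aP f)].
  have aL : linear (fun f => \row_j a f j).
    move=> c f g; apply/rowP => j; rewrite !mxE -a_pi.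
    apply: (a_eq _ (fun j => c * a f j + a g j)); first exact: pihomogP.
    have [[Hf _] [Hg _]] := (aP f, aP g).
    rewrite /eqmod linearP /=.
    have -> : \sum_j (c * a f j + a g j) *: b j =
              c *: \sum_j a f j *: b j + \sum_j a g j *: b j.
      by rewrite scaler_sumr -big_split; apply: eq_bigr => j' _; rewrite scalerDl scalerA.
    rewrite opprD addrACA -scalerBr; apply: idealD => //; exact: idealZ.
  pose phi : {linear {mpoly K[m]} -> 'rV[K]_d} :=
    HB.pack (fun f => \row_j a f j)
      (GRing.isLinear.Build K {mpoly K[m]} 'rV[K]_d _ _ aL).
  exists phi; split=> [f f_t|v].
    split=> [If|/rowP phi0].
      apply/rowP=> j; rewrite !mxE (a_eq f (fun=> 0)) //.
      by rewrite /eqmod big1 ?subr0 // => i _; rewrite scale0r.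
    have [Hf _] := aP f; move: Hf.
    rewrite pihomog_dE // /eqmod big1 ?subr0 // => j _.
    by have := phi0 j; rewrite !mxE => ->; rewrite scale0r.
  exists (\sum_j v 0 j *: b j).
    by apply: rpred_sum => j _; apply: rpredZ; apply: b_t.
  apply/rowP=> j; rewrite !mxE (a_eq _ (fun j => v 0 j)) //.
    by apply: rpred_sum => j' _; apply: rpredZ; apply: b_t.
  by rewrite /eqmod subrr; apply: ideal0.
have /choice_fun[b bP] (j : 'I_d) : exists f, f \is t.-homog /\ phi f = delta_mx 0 j.
  by have [f f_t phif] := surjP (delta_mx 0 j); exists f.
exists b; split=> [j|f f_t]; first by case: (bP j).
have comb_t (a : {ffun 'I_d -> K}) : \sum_j a j *: b j \is t.-homog.
  by apply: rpred_sum => j _; apply: rpredZ; case: (bP j).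
have phi_comb (a : {ffun 'I_d -> K}) : phi (\sum_j a j *: b j) = \row_j a j.
  rewrite linear_sum [RHS]row_sum_delta; apply: eq_bigr => j _.
  by rewrite linearZ /= mxE; case: (bP j) => _ ->.
exists [ffun j => phi f 0 j]; split=> [|a].
  apply/kerP; first by rewrite rpredB.
  rewrite linearB /= phi_comb; apply/rowP => j; rewrite !mxE !ffunE; exact: subrr.
move=> /kerP; rewrite rpredB // => /(_ isT) /eqP.
rewrite linearB /= phi_comb subr_eq0 => /eqP ->.
by apply/ffunP=> j; rewrite ffunE mxE.
Qed.

Lemma hilbert_function_eq0 h t : hilbert_function I h -> h t = 0%N ->
  forall f, f \is t.-homog -> I f.
Proof.
move=> hilbI ht0 f f_t; have [b [_ /(_ f f_t) [a []]]] := hilbI t.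
move: a b; rewrite ht0 => a b; rewrite /eqmod big_ord0 subr0 //.
Qed.

(** A standard graded algebra is generated in degree 1, so $A_{t+1}$ is spanned by products of
    variables with elements of $A_t$. *)
Lemma hilbert_function_eq0S h t : hilbert_function I h -> h t = 0%N ->
  h t.+1 = 0%N.
Proof.
move=> hilbI ht0; have It := hilbert_function_eq0 hilbI ht0.
have It1 f : f \is t.+1.-homog -> I f.
  move=> f_t1; suff: forall s g, g \is s.-homog -> s = t.+1 -> I g.
    by move=> /(_ _ _ f_t1 erefl).
  (* Homogeneity is carried along because the cofactor of a variable must be homogeneous of degree
     [t] to lie in [I]. *)
  have H : forall s g, g \is s.-homog -> [/\ g \is s.-homog & s = t.+1 -> I g].
    apply: homog_ind => [|s|s c g1 g2 [h1 I1] [h2 I2]|s i g [g_s _]].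
    - by rewrite dhomog1.
    - by split=> [|_]; [exact: dhomog0|exact: ideal0].
    - split; first by apply: rpredD => //; apply: rpredZ.
      by move=> st; apply: idealD; [exact/idealZ/I1|exact: I2].
    - split; first by rewrite -add1n dhomogM // homogX1.
      by case=> st; apply/idealMl/It; rewrite -st.
  by move=> s g /H[].
have /graded_dim_coord[phi [kerP surjP]] := hilbI t.+1.
apply/eqP; rewrite -leqn0 leqNgt; apply/negP => h_gt0.
have [f f_t1 phif] := surjP (const_mx 1).
have /rowP/(_ (Ordinal h_gt0)) : phi f = 0 by apply/kerP => //; apply: It1.
by rewrite phif !mxE => /eqP; rewrite oner_eq0.
Qed.

End IdealTheory.

(** * Quotients by linear forms *)

Definition adjoin I l : {mpoly K[m]} -> Prop := fun f => exists a, I (f - a * l).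

Lemma add_gens_nil I : add_gens I [::] = I.
Proof.
apply: pred_ext => f; rewrite /add_gens /eqmod; split=> [[a]|If].
  by rewrite big_ord0 subr0.
by exists (fun=> 0); rewrite big_ord0 subr0.
Qed.

Lemma add_gens_cons I l s : add_gens I (l :: s) = adjoin (add_gens I s) l.
Proof.
apply: pred_ext => f; rewrite /add_gens /adjoin /eqmod; split=> [[a]|[a0 [a]]].
  rewrite big_ord_recl /= => If; exists (a ord0), (fun j => a (lift ord0 j)).
  by rewrite -addrA -opprD.
move=> If; exists (fun j => if unlift ord0 j is Some j' then a j' else a0).
rewrite big_ord_recl unlift_none opprD addrA.
by under eq_bigr do rewrite liftK.
Qed.

Lemma adjoinC I l l' : adjoin (adjoin I l) l' = adjoin (adjoin I l') l.
Proof.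
apply: pred_ext => f.
by split=> -[a [b Iab]]; exists b, a; rewrite addrAC.
Qed.

(** This lets the first form of a sequence be divided out before all the others. *)
Lemma add_gens_adjoin I l s : add_gens (adjoin I l) s = adjoin (add_gens I s) l.
Proof.
elim: s => [|l' s IHs]; first by rewrite !add_gens_nil.
by rewrite !add_gens_cons IHs adjoinC.
Qed.

(** Each prefix of a tuple extends the previous one at its end, so successive quotients differ by
    one [adjoin]. *)
Lemma add_gens_rcons I l s : add_gens I (rcons s l) = adjoin (add_gens I s) l.
Proof.
elim: s => [|l' s IHs] /=; first by rewrite add_gens_cons.
by rewrite !add_gens_cons IHs adjoinC.
Qed.

Lemma homogeneous_adjoin I l : homogeneous_ideal I -> l \is 1.-homog ->
  homogeneous_ideal (adjoin I l).
Proof.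
move=> homI l_1; split.
- by exists 0; rewrite mul0r subr0; apply: ideal0.
- move=> f g [a Ia] [b Ib]; exists (a + b).
  by rewrite mulrDl opprD addrACA; apply: idealD.
- by move=> f g [a Ia]; exists (f * a); rewrite -mulrA -mulrBr; apply: idealMl.
- move=> f [|t] [a /(ideal_pihomog homI) Ia].
    exists 0; have := Ia 0%N; rewrite pihomogB mulrC (pihomogMl_lt _ l_1) //.
    by rewrite mul0r.
  exists (pihomog mdeg t a); have := Ia t.+1.
  by rewrite pihomogB mulrC pihomogMl1 // mulrC.
Qed.

(* In degree i + 1, A / (l) is the cokernel of the multiplication map
   A_i -> A_(i + 1), which has full rank. *)
Lemma hilbert_function_adjoin I l h : homogeneous_ideal I ->
  hilbert_function I h -> WLP I l -> hilbert_function (adjoin I l) (delta h).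
Proof.
move=> homI hilbI [l_1 fullI]; have homIl := homogeneous_adjoin homI l_1.
case=> [|i].
  apply/(graded_dim_coord homIl).
  have /(graded_dim_coord homI)[phi [kerP surjP]] := hilbI 0%N.
  (* Multiples of [l] have no component of degree 0, so the coordinates on $A_0$ also serve the
     quotient. *)
  exists phi; split=> // f f_0; rewrite -kerP //; split=> [[a]|If].
    move=> /(ideal_pihomog homI 0).
    by rewrite pihomogB mulrC (pihomogMl_lt _ l_1) // pihomog_dE // subr0.
  by exists 0; rewrite mul0r subr0.
have /(graded_dim_coord homI)[psi [kerpsi surjpsi]] := hilbI i.
have /(graded_dim_coord homI)[phi [kerphi surjphi]] := hilbI i.+1.
have /choice_fun[b bP] (j : 'I_(h i)) :
    exists f, f \is i.-homog /\ psi f = delta_mx 0 j.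
  by have [f f_t psif] := surjpsi (delta_mx 0 j); exists f.
have la_t a : a \is i.-homog -> a * l \is i.+1.-homog.
  by move=> a_i; rewrite -addn1; apply: dhomogM.
(* The matrix of multiplication by [l] from $A_i$ to $A_{i+1}$, in the coordinates [psi] and
   [phi]. *)
pose M : 'M_(h i, h i.+1) := \matrix_j phi (b j * l).
have phi_mul a : a \is i.-homog -> phi (a * l) = psi a *m M.
  move=> a_i; have comb_i : \sum_j psi a 0 j *: b j \is i.-homog.
    by apply: rpred_sum => j _; apply: rpredZ; case: (bP j).
  have /(idealMl homI l) : I (a - \sum_j psi a 0 j *: b j).
    apply/kerpsi; first by apply: rpredB.
    rewrite linearB linear_sum {1}[psi a]row_sum_delta; apply/eqP.
    rewrite subr_eq0; apply/eqP/eq_bigr => j _; rewrite linearZ /=.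
    by case: (bP j) => _ ->.
  rewrite mulrBr ![l * _]mulrC => /kerphi.
  rewrite rpredB ?la_t // => /(_ isT) /eqP.
  rewrite linearB /= subr_eq0 => /eqP ->.
  rewrite mulr_suml linear_sum mulmx_sum_row; apply: eq_bigr => j _.
  by rewrite -scalerAl linearZ rowK.
have rankM : (\rank M = minn (h i) (h i.+1))%N.
  have := rank_leq_row M; have := rank_leq_col M.
  case: (fullI i) => [injI|surjI].
    suff : row_free M by rewrite /row_free => /eqP; lia.
    apply: inj_row_free => v vM0; have [a a_i psi_a] := surjpsi v.
    rewrite -psi_a; apply/kerpsi => //; rewrite -[a]subr0.
    apply: injI; rewrite ?dhomog0 //.
    rewrite /eqmod mulr0 subr0 expr1 mulrC; apply/kerphi; first exact: la_t.
    by rewrite phi_mul // psi_a.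
  suff : row_full M by rewrite /row_full => /eqP; lia.
  rewrite -sub1mx; apply/row_subP => j.
  have [f f_t <-] := surjphi (row j 1%:M).
  have [|a a_i Ia] := surjI f; first by rewrite addn1.
  suff -> : phi f = psi a *m M by apply: submxMl.
  rewrite -phi_mul //; apply/eqP; rewrite eq_sym -subr_eq0 -linearB.
  apply/eqP/kerphi; first by rewrite rpredB ?la_t.
  by rewrite mulrC; move: Ia; rewrite /eqmod expr1.
(* Subtracting the minimum of [h i] and [h i.+1] from [h i.+1] is exactly truncated subtraction. *)
have rankC : \rank (cokermx M) = delta h i.+1.
  by rewrite mxrank_coker rankM /=; lia.
apply/(graded_dim_coord homIl); rewrite -rankC.
(* [C] has independent columns, as many as the rank of the cokernel matrix, and its kernel is the
   row space of [M]; hence [phi] followed by [C] gives coordinates on the quotient. *)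
pose C := col_base (cokermx M).
have adjoinP f : f \is i.+1.-homog ->
    adjoin I l f <-> exists2 a, a \is i.-homog & phi f = psi a *m M.
  move=> f_t; split=> [[a]|[a a_i phi_f]].
    move=> /(ideal_pihomog homI i.+1).
    rewrite pihomogB mulrC pihomogMl1 // pihomog_dE //.
    have a_i := pihomogP mdeg i a; rewrite mulrC => /kerphi.
    rewrite rpredB ?la_t // => /(_ isT) /eqP; rewrite linearB subr_eq0 => /eqP phi_f.
    by exists (pihomog mdeg i a); rewrite ?phi_f ?phi_mul.
  exists a; apply/kerphi; first by rewrite rpredB ?la_t.
  by rewrite linearB /= phi_mul // phi_f subrr.
have kerC v : (v *m C = 0) <-> (v <= M)%MS.
  have -> : (v <= M)%MS = (v *m C *m row_base (cokermx M) == 0).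
    by rewrite -mulmxA mulmx_base submxE.
  split=> [->|/eqP]; first by rewrite mul0mx.
  by rewrite -[0](mul0mx _ (row_base (cokermx M))) => /(row_free_inj (row_base_free _)).
exists (mulmxr C \o phi); split=> /= [f f_t|v].
  rewrite adjoinP // kerC; split=> [[a _ ->]|/submxP[v phi_f]].
    exact: submxMl.
  by have [a a_i psi_a] := surjpsi v; exists a; rewrite ?psi_a.
have /submxP[w ->] : (v <= C)%MS by apply: submx_full; apply: col_base_full.
by have [f f_t <-] := surjphi w; exists f.
Qed.

End Ideals.

(** * Hilbert functions of algebras with the k-WLP *)

Section FromWLP.
Variables (K : fieldType) (m : nat).
Implicit Types (I : {mpoly K[m]} -> Prop) (l : {mpoly K[m]}) (h : nat -> nat).

(** The peak is the first index at which [h] fails to increase; the zero of [h] ensures that there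
    is one. There [delta h] vanishes at the next index, and it stays zero, being the Hilbert
    function of $A/(l)$. *)
Lemma WLP_unimodal I l h t : homogeneous_ideal I -> hilbert_function I h ->
  WLP I l -> h t = 0%N -> unimodal h.
Proof.
move=> homI hilbI wlp ht0.
have ex_descent : exists i, (h i.+1 <= h i)%N.
  by exists t; rewrite (hilbert_function_eq0S homI hilbI ht0).
case: (ex_minnP ex_descent) => i le_i min_i; exists i; split=> j.
  by move=> lt_ji; rewrite ltnNge; apply/negP => /min_i; rewrite leqNgt lt_ji.
have homIl := homogeneous_adjoin homI (proj1 wlp).
have hilbIl := hilbert_function_adjoin homI hilbI wlp.
move=> le_ij; suff : delta h j.+1 = 0%N by rewrite /=; lia.
rewrite -(subnK le_ij); elim: (j - i)%N => [|d IHd]; first by rewrite add0n /=; lia.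
by rewrite addSn (hilbert_function_eq0S homIl hilbIl).
Qed.

(** A zero of each iterated difference is carried through the induction, since unimodality of each
    quotient requires one. *)
Lemma kWLP_hilbert I h k (g : k.-tuple {mpoly K[m]}) t :
  homogeneous_ideal I -> hilbert_function I h -> h t = 0%N ->
  (forall i : 'I_k, WLP (add_gens I (take i g)) (tnth g i)) ->
  forall i, (i <= k)%N ->
    [/\ homogeneous_ideal (add_gens I (take i g)),
        hilbert_function (add_gens I (take i g)) (iter i delta h)
      & exists s, iter i delta h s = 0%N].
Proof.
move=> homI hilbI ht0 wlp; elim=> [|i IHi] lt_ik.
  by rewrite take0 add_gens_nil; split=> //; exists t.
have [homJ hilbJ [s hs0]] := IHi (ltnW lt_ik).
have := wlp (Ordinal lt_ik); rewrite (tnth_nth 0) /= => wlpJ.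
rewrite (take_nth 0) ?size_tuple // add_gens_rcons; split.
- exact: homogeneous_adjoin (proj1 wlpJ).
- exact: hilbert_function_adjoin.
- by exists s.+1; rewrite /= (hilbert_function_eq0S homJ hilbJ).
Qed.

End FromWLP.

(** * Adding a variable *)

Section Substitution.
Variables (K : fieldType) (n k : nat) (F : 'I_n -> {mpoly K[k]}).
Implicit Types f : {mpoly K[n]}.

Definition subst f : {mpoly K[k]} := f \mPo [tuple F i | i < n].

HB.instance Definition _ := GRing.RMorphism.copy subst
  (comp_mpoly [tuple F i | i < n]).
HB.instance Definition _ := GRing.Linear.copy subst
  (comp_mpoly [tuple F i | i < n]).

Lemma substX i : subst 'X_i = F i.
Proof. by rewrite /subst comp_mpolyXU -tnth_nth tnth_mktuple. Qed.

Hypothesis F_homog : forall i, F i \is 1.-homog.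

Lemma subst_homog t f : f \is t.-homog -> subst f \is t.-homog.
Proof.
move: t f; apply: homog_ind => [|t|t c f g f_t g_t|t i f f_t].
- by rewrite rmorph1 dhomog1.
- by rewrite rmorph0 dhomog0.
- by rewrite linearP; apply: rpredD => //; apply: rpredZ.
- by rewrite rmorphM /= substX -add1n dhomogM.
Qed.

Lemma pihomog_subst t f : pihomog mdeg t (subst f) = subst (pihomog mdeg t f).
Proof.
move: f t; apply: mpoly_ind_vars => [|c f g IHf IHg|i f IHf] t.
- rewrite rmorph1; case: t => [|t]; first by rewrite !pihomog_dE ?dhomog1 ?rmorph1.
  by rewrite !(@pihomog_ne0 _ _ _ 0) ?dhomog1 ?rmorph0.
- by rewrite !linearP /= IHf IHg.
rewrite rmorphM /= substX; case: t => [|t]; last first.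
  by rewrite !pihomogMl1 ?homogX1 // IHf rmorphM /= substX.
by rewrite (pihomogMl_lt _ (F_homog i)) // (pihomogMl_lt _ (homogX1 K i)) ?rmorph0.
Qed.

End Substitution.

(** * The new variable and its specializations *)

Section NewVariable.
Variables (K : fieldType) (m : nat).
Implicit Types (f : {mpoly K[m.+1]}) (q l : {mpoly K[m]}).

Definition newvar : {mpoly K[m.+1]} := 'X_ord0.
Definition embed := subst (fun i : 'I_m => 'X_(lift ord0 i) : {mpoly K[m.+1]}).
(** The value 0 passes to the quotient by the new variable and the value 1 dehomogenizes; both are
    left inverses of [embed]. *)
Definition eval_newvar (c : {mpoly K[m]}) :=
  subst (fun i : 'I_m.+1 => if unlift ord0 i is Some j then 'X_j else c).
Definition kill := eval_newvar 0.
Definition dehomog := eval_newvar 1.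

HB.instance Definition _ := GRing.RMorphism.on embed.
HB.instance Definition _ := GRing.Linear.on embed.
HB.instance Definition _ c := GRing.RMorphism.on (eval_newvar c).
HB.instance Definition _ c := GRing.Linear.on (eval_newvar c).
HB.instance Definition _ := GRing.RMorphism.on kill.
HB.instance Definition _ := GRing.Linear.on kill.
HB.instance Definition _ := GRing.RMorphism.on dehomog.
HB.instance Definition _ := GRing.Linear.on dehomog.

Lemma newvar_homog : newvar \is 1.-homog. Proof. exact: homogX1. Qed.

Lemma newvarX_homog s : newvar ^+ s \is s.-homog.
Proof. by have := dhomogMn s newvar_homog; rewrite mul1n. Qed.

Lemma eval_newvar_lift c i : eval_newvar c 'X_(lift ord0 i) = 'X_i.
Proof. by rewrite /eval_newvar substX liftK. Qed.

Lemma eval_newvarE c : eval_newvar c newvar = c.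
Proof. by rewrite /eval_newvar substX unlift_none. Qed.

Lemma embedX i : embed 'X_i = 'X_(lift ord0 i).
Proof. by rewrite /embed substX. Qed.

Lemma embedK c : cancel embed (eval_newvar c).
Proof.
apply: mpoly_ind_vars => [|a f g IHf IHg|i f IHf].
- by rewrite !rmorph1.
- by rewrite !linearP /= IHf IHg.
- by rewrite !rmorphM /= IHf embedX eval_newvar_lift.
Qed.

Lemma embed_homog t q : q \is t.-homog -> embed q \is t.-homog.
Proof. by apply: subst_homog => i; apply: homogX1. Qed.

Lemma pihomog_embed t q : pihomog mdeg t (embed q) = embed (pihomog mdeg t q).
Proof. by apply: pihomog_subst => i; apply: homogX1. Qed.

Lemma kill_homog t f : f \is t.-homog -> kill f \is t.-homog.
Proof.
by apply: subst_homog => i; case: unlift => [j|]; rewrite ?homogX1 ?dhomog0.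
Qed.

Lemma pihomog_kill t f : pihomog mdeg t (kill f) = kill (pihomog mdeg t f).
Proof.
by apply: pihomog_subst => i; case: unlift => [j|]; rewrite ?homogX1 ?dhomog0.
Qed.

Lemma embed_kill f : exists a, f = embed (kill f) + a * newvar.
Proof.
move: f; apply: mpoly_ind_vars => [|c f g [a ->] [b ->]|i f [a fE]].
- by exists 0; rewrite !rmorph1 mul0r addr0.
- exists (c *: a + b); rewrite !(linearD, linearZ, rmorphM) /= /kill.

  rewrite !embedK eval_newvarE rmorph0 !mulr0 !addr0 scaler0 addr0.
  by rewrite mulrDl -scalerAl addrACA.
- case: (unliftP ord0 i) => [j ->|->].
    exists ('X_(lift ord0 j) * a).
    by rewrite !rmorphM /= /kill eval_newvar_lift embedX {1}fE mulrDr mulrA.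
  by exists f; rewrite rmorphM /= /kill eval_newvarE mul0r rmorph0 add0r mulrC.
Qed.

(** A term $z^e q$ of degree [t] becomes [q], of degree $t-e$. Only terms with $e=0$ reach degree
    [t], and these are the ones [kill] keeps. *)
Lemma dehomog_homog t f : f \is t.-homog ->
  (forall d, (t < d)%N -> pihomog mdeg d (dehomog f) = 0) /\
  pihomog mdeg t (dehomog f) = kill f.
Proof.
move: t f; apply: homog_ind => [|t|t c f g [IHf IHf'] [IHg IHg']|t i f [IHf IHf']].
- rewrite !rmorph1 pihomog_dE ?dhomog1 //; split=> // d d_gt0.
  by rewrite (@pihomog_ne0 _ _ _ 0) ?dhomog1 // eq_sym -lt0n.
- by rewrite !rmorph0; split=> [d _|]; rewrite pihomog0.
- rewrite !linearP /= IHf' IHg'; split=> // d lt_td.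
  by rewrite linearP /= IHf // IHg // scaler0 addr0.
- rewrite !rmorphM /= /dehomog /kill.
  case: (unliftP ord0 i) => [j ->|->].
    rewrite !eval_newvar_lift pihomogMl1 ?homogX1 // IHf'; split=> // -[|d] //.
    by rewrite ltnS pihomogMl1 ?homogX1 // => /IHf ->; rewrite mulr0.
  rewrite !eval_newvarE mul1r mul0r; split=> [d /ltnW|]; exact: IHf.
Qed.

Section Transfer.
Variables (J : {mpoly K[m.+1]} -> Prop) (J' : {mpoly K[m]} -> Prop).
Hypothesis killJ : forall f, J f <-> J' (kill f).

(** By [killJ], [kill] induces an isomorphism of quotients with inverse induced by [embed], and both
    respect degrees. *)
Lemma SLP_embed l : SLP J' l -> SLP J (embed l).
Proof.
move=> [l_1 fullJ]; split=> [|i s s_gt0]; first exact: embed_homog.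
have kill_mul f : kill (embed l ^+ s * f) = l ^+ s * kill f.
  by rewrite rmorphM rmorphXn /= /kill embedK.
case: (fullJ i s s_gt0) => [inj|surj]; [left|right].
  move=> f g f_i g_i; rewrite /eqmod !killJ !rmorphB /= !kill_mul.
  by apply: inj; apply: kill_homog.
move=> g g_is; have [f f_i Jf] := surj _ (kill_homog g_is).
exists (embed f); first exact: embed_homog.
by rewrite /eqmod killJ rmorphB /= kill_mul /kill embedK.
Qed.

Lemma add_gens_embed s f :
  add_gens J (map embed s) f <-> add_gens J' s (kill f).
Proof.
elim: s f => [|l s IHs] f; first by rewrite !add_gens_nil.
rewrite /= !add_gens_cons /adjoin; split=> [[a]|[a Ja]].
  by rewrite IHs rmorphB rmorphM /= /kill embedK; exists (kill a).
by exists (embed a); rewrite IHs rmorphB rmorphM /= /kill !embedK.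
Qed.

End Transfer.
End NewVariable.

Section Entry.
Variables (K : fieldType) (d : nat).

(** Natural indices with default 0 avoid casts between row vectors of different lengths. *)
Definition entry (v : 'rV[K]_d) (k : nat) : K :=
  if insub k is Some i then v 0 i else 0.

Lemma entry_ord v (i : 'I_d) : entry v i = v 0 i.
Proof. by rewrite /entry valK. Qed.

Lemma entryP k c u v : entry (c *: u + v) k = c * entry u k + entry v k.
Proof. by rewrite /entry; case: insubP => [i _ _|_]; rewrite ?mxE ?mulr0 ?addr0. Qed.

Lemma entry0 k : entry 0 k = 0.
Proof. by rewrite /entry; case: insubP => [i _ _|_]; rewrite ?mxE. Qed.
End Entry.

(** For [t] up to the peak, this is the number of basis elements of $B$ of degree below [t], hence
    the index where the block of degree [t] starts. *)
Definition before (h : nat -> nat) t : nat := if t is s.+1 then h s else 0%N.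

Lemma deltaE h t : delta h t = (h t - before h t)%N.
Proof. by case: t => //=; rewrite subn0. Qed.

(** * Unimodal sequences and their blocks of indices *)

Section Peak.
Variables (h : nat -> nat) (p : nat).
Hypothesis h_incr : forall j, (j < p)%N -> (h j < h j.+1)%N.
Hypothesis h_decr : forall j, (p <= j)%N -> (h j.+1 <= h j)%N.

Lemma peak_mono s t : (s <= t)%N -> (t <= p)%N -> (h s <= h t)%N.
Proof.
move=> le_st; rewrite -(subnK le_st); elim: (t - s)%N => [|d IHd] //.
by rewrite addSn => lt_p; apply: leq_trans (ltnW (h_incr lt_p)); apply/IHd/ltnW.
Qed.

Lemma peak_anti s t : (p <= s)%N -> (s <= t)%N -> (h t <= h s)%N.
Proof.
move=> le_ps le_st; rewrite -(subnK le_st); elim: (t - s)%N => [|d IHd] //.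
by rewrite addSn; apply: leq_trans (h_decr _) IHd; lia.
Qed.

Lemma peak_max t : (h t <= h p)%N.
Proof.
by case: (leqP t p) => [le_tp|/ltnW le_pt]; [apply: peak_mono|apply: peak_anti].
Qed.

Lemma delta_after_peak t : (p < t)%N -> delta h t = 0%N.
Proof. by case: t => // t; rewrite ltnS => /h_decr /=; lia. Qed.

(** Take the least [t] with [j < h t]: it is at most [p], which qualifies, and minimality gives the
    lower bound. *)
Lemma block_exists j : (j < h p)%N ->
  exists t, [/\ (t <= p)%N, (before h t <= j)%N & (j < h t)%N].
Proof.
move=> lt_jp; have ex_t : exists t, (j < h t)%N by exists p.
case: (ex_minnP ex_t) => t lt_jt min_t; exists t; split=> //; first exact: min_t.
case: t lt_jt min_t => // t _ min_t /=.
by rewrite leqNgt; apply/negP => /min_t; rewrite ltnn.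
Qed.

Lemma block_le s t j : (s <= p)%N -> (before h s <= j)%N ->
  (j < h t)%N -> (s <= t)%N.
Proof.
case: s => // s le_sp /= le_hj lt_jh; rewrite ltnNge; apply/negP => le_ts.
by have := peak_mono le_ts (ltnW le_sp); lia.
Qed.

End Peak.

(** * Coordinates adapted to the grading *)

Section GradedCoordinates.
Variables (K : fieldType) (m : nat) (I : {mpoly K[m]} -> Prop).
Variables (h : nat -> nat) (p : nat).
Hypothesis h_incr : forall j, (j < p)%N -> (h j < h j.+1)%N.
Hypothesis h_decr : forall j, (p <= j)%N -> (h j.+1 <= h j)%N.
Hypothesis homI : homogeneous_ideal I.
Hypothesis hilbI : hilbert_function I (delta h).

(* The indices j of the degree d part of the basis are those of the block
   h (d - 1) <= j < h d; [phi] gives the coordinates in the basis [b]. *)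
Lemma graded_coordinates : exists (deg : 'I_(h p) -> nat)
    (phi : {linear {mpoly K[m]} -> 'rV[K]_(h p)}) (b : 'I_(h p) -> {mpoly K[m]}),
  [/\ forall f, I f <-> phi f = 0,
      forall f j, phi (pihomog mdeg (deg j) f) 0 j = phi f 0 j,
      forall j, b j \is (deg j).-homog /\ phi (b j) = delta_mx 0 j
    & forall j, [/\ (deg j <= p)%N, (before h (deg j) <= j)%N & (j < h (deg j))%N]].
Proof.
have /choice_fun[deg degP] (j : 'I_(h p)) := block_exists (ltn_ord j).
have /choice_fun[Phi PhiP] t := proj1 (graded_dim_coord homI t _) (hilbI t).
have entry_neq0 (j : 'I_(h p)) : (j - before h (deg j) < delta h (deg j))%N.
  by have [_ ? ?] := degP j; rewrite deltaE; lia.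
(* The coordinates on all graded pieces are concatenated; the difference is the offset of [j] inside
   its block. *)
pose phi0 f : 'rV[K]_(h p) := \row_j
  entry (Phi (deg j) (pihomog mdeg (deg j) f)) (j - before h (deg j)).
have phi0L : linear phi0.
  by move=> c f g; apply/rowP=> j; rewrite !mxE !linearP entryP.
pose phi : {linear {mpoly K[m]} -> 'rV[K]_(h p)} :=
  HB.pack phi0 (GRing.isLinear.Build K {mpoly K[m]} 'rV[K]_(h p) _ _ phi0L).
have phiE f j : phi f 0 j =
  entry (Phi (deg j) (pihomog mdeg (deg j) f)) (j - before h (deg j)).
  by rewrite mxE.
have /choice_fun[b bP] (j : 'I_(h p)) : exists f, f \is (deg j).-homog /\
    Phi (deg j) f = delta_mx 0 (Ordinal (entry_neq0 j)).
  have [_ surj] := PhiP (deg j).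
  by have [f f_t Ef] := surj (delta_mx 0 (Ordinal (entry_neq0 j))); exists f.
exists deg, phi, b; split=> // [f|f j|j].
- split=> [If|phif0].
    apply/rowP=> j; rewrite phiE mxE.
    have [kerPhi _] := PhiP (deg j).
    have -> : Phi (deg j) (pihomog mdeg (deg j) f) = 0.
      by apply/kerPhi; [exact: pihomogP|exact: ideal_pihomog].
    exact: entry0.
  (* Beyond the peak [delta h] is 0, so those components lie in [I] already. Up to the peak, entry
     [k] in degree [t] has global index [before h t + k]. *)
  apply: ideal_homog_comp => // t; case: (leqP t p) => [le_tp|lt_pt]; last first.
    apply: (hilbert_function_eq0 hilbI (delta_after_peak h_decr lt_pt)).
    exact: pihomogP.
  have [kerPhi _] := PhiP t; apply/kerPhi; first exact: pihomogP.
  apply/rowP=> k; rewrite mxE -entry_ord.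
  have lt_kt := ltn_ord k; rewrite [X in (_ < X)%N]deltaE in lt_kt.
  have lt_jt : (before h t + k < h t)%N by lia.
  have lt_jp := leq_trans lt_jt (peak_max h_incr h_decr t).
  have /rowP/(_ (Ordinal lt_jp)) := phif0; rewrite phiE mxE.
  have [le_dp le_bj lt_jd] := degP (Ordinal lt_jp).
  have -> : deg (Ordinal lt_jp) = t.
    apply/eqP; rewrite eqn_leq (block_le h_incr le_dp le_bj) //=.
    by apply: (block_le h_incr le_tp _ lt_jd); rewrite /= leq_addr.
  by rewrite /= addKn.
- by rewrite !phiE pihomog_id.
have [b_t Phib] := bP j; split=> //; apply/rowP=> i; rewrite phiE mxE eqxx /=.
have [le_ip le_bi lt_ii] := degP i; have [le_jp le_bj lt_jj] := degP j.
have [deg_ij|deg_ij] := eqVneq (deg i) (deg j); last first.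
  rewrite (pihomog_ne0 _ b_t) 1?eq_sym // linear0 entry0.
  by case: (eqVneq i j) deg_ij => [->|]; rewrite ?eqxx.
rewrite deg_ij pihomog_dE // Phib /entry; case: insubP => [k _ kE|].
  rewrite mxE eqxx -!val_eqE /= kE; congr (_ %:R).
  rewrite deg_ij in le_bi; congr nat_of_bool; apply/eqP/eqP; lia.
by rewrite -deg_ij entry_neq0.
Qed.

End GradedCoordinates.

(** * Extension of an algebra by one variable *)

Section Extension.
Variables (K : fieldType) (m : nat) (I : {mpoly K[m]} -> Prop).
Variables (h : nat -> nat) (p : nat).
Hypothesis h_incr : forall j, (j < p)%N -> (h j < h j.+1)%N.
Hypothesis h_decr : forall j, (p <= j)%N -> (h j.+1 <= h j)%N.
Hypothesis homI : homogeneous_ideal I.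
Variables (deg : 'I_(h p) -> nat) (phi : {linear {mpoly K[m]} -> 'rV[K]_(h p)})
  (b : 'I_(h p) -> {mpoly K[m]}).
Hypothesis kerphi : forall f, I f <-> phi f = 0.
Hypothesis phi_pihomog : forall f j, phi (pihomog mdeg (deg j) f) 0 j = phi f 0 j.
Hypothesis b_homog : forall j, b j \is (deg j).-homog.
Hypothesis phi_b : forall j, phi (b j) = delta_mx 0 j.
Hypothesis degP :
  forall j, [/\ (deg j <= p)%N, (before h (deg j) <= j)%N & (j < h (deg j))%N].

Notation z := (newvar K m).
Notation deh := (@dehomog K m).

(** The ideal defining $A$: in degree [t], the dehomogenization must lie in the span of the [b j]
    with [h t <= j], modulo [I]. *)
Definition extension (f : {mpoly K[m.+1]}) : Prop :=
  forall t (j : 'I_(h p)), (j < h t)%N -> phi (deh (pihomog mdeg t f)) 0 j = 0.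

Lemma deg_le (j : 'I_(h p)) t : (j < h t)%N -> (deg j <= t)%N.
Proof. by have [le_jp le_bj _] := degP j; apply: (block_le h_incr le_jp le_bj). Qed.

Lemma phi_pihomog_neq f j t : t != deg j -> phi (pihomog mdeg t f) 0 j = 0.
Proof.
move=> neq_t; rewrite -phi_pihomog (pihomog_ne0 neq_t) ?pihomogP //.
by rewrite linear0 mxE.
Qed.

Lemma phi_dehomog_high f t j : f \is t.-homog -> (t < deg j)%N ->
  phi (deh f) 0 j = 0.
Proof.
move=> f_t lt_t; rewrite -phi_pihomog.
by rewrite (proj1 (dehomog_homog f_t)) // linear0 mxE.
Qed.

Lemma extension_homogP f t : f \is t.-homog ->
  extension f <-> (forall j : 'I_(h p), (j < h t)%N -> phi (deh f) 0 j = 0).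
Proof.
move=> f_t; split=> [ext_f j|phi_f s j lt_js].
  by have := ext_f t j; rewrite pihomog_dE.
have [eq_st|neq_st] := eqVneq t s.
  by rewrite -eq_st pihomog_dE // phi_f // eq_st.
by rewrite (pihomog_ne0 neq_st f_t) !linear0 mxE.
Qed.

(** Up to the peak nothing is divided out: [deh f] has degree at most [t], and the blocks of these
    degrees consist of indices below [h t]. *)
Lemma extension_below_peak f t : f \is t.-homog -> (t <= p)%N ->
  (forall j : 'I_(h p), (j < h t)%N -> phi (deh f) 0 j = 0) -> I (deh f).
Proof.
move=> f_t le_tp phi_f; apply/kerphi/rowP=> j; rewrite [RHS]mxE.
have [lt_jt|le_tj] := ltnP j (h t); first exact: phi_f.
have [le_dp _ lt_jd] := degP j.
apply: (phi_dehomog_high f_t); rewrite ltnNge; apply/negP => le_dt.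
by have := peak_mono h_incr le_dt le_tp; lia.
Qed.

(** Up to the peak [deh f] is in [I]. Beyond it [h] does not grow, which settles [z]. For another
    variable, a coordinate [j] of degree [e.+1] depends only on the component of degree [e], whose
    indices are below [h e <= j < h t], where the coordinates vanish. *)
Lemma extension_mulX i f t : f \is t.-homog ->
  (forall j : 'I_(h p), (j < h t)%N -> phi (deh f) 0 j = 0) ->
  forall j : 'I_(h p), (j < h t.+1)%N -> phi (deh ('X_i * f)) 0 j = 0.
Proof.
move=> f_t phi_f j lt_jt; rewrite rmorphM /=.
have [le_tp|lt_pt] := leqP t p.
  have If := extension_below_peak f_t le_tp phi_f.
  by have /kerphi -> := idealMl homI (deh 'X_i) If; rewrite mxE.
have lt_jt' : (j < h t)%N by apply: leq_trans lt_jt (h_decr (ltnW lt_pt)).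
case: (unliftP ord0 i) => [i' ->|->]; last first.
  by rewrite /dehomog eval_newvarE mul1r; apply: phi_f.
rewrite {1}/dehomog eval_newvar_lift -phi_pihomog.
have [_ le_bj _] := degP j; case deg_j: (deg j) le_bj => [|e] /= le_ej.
  by rewrite (pihomogMl_lt _ (homogX1 K i')) // linear0 mxE.
rewrite pihomogMl1 ?homogX1 //.
suff /(idealMl homI 'X_i')/kerphi -> : I (pihomog mdeg e (deh f)) by rewrite mxE.
apply/kerphi/rowP=> j'; rewrite [RHS]mxE.
have [eq_e|] := eqVneq e (deg j'); last exact: phi_pihomog_neq.
have [_ _ lt_j'] := degP j'.
by rewrite eq_e phi_pihomog phi_f // (leq_trans lt_j') // -eq_e; lia.
Qed.

Lemma homogeneous_extension : homogeneous_ideal extension.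
Proof.
have extL c f g : extension f -> extension g -> extension (c *: f + g).
  by move=> ext_f ext_g t j lt_jt; rewrite !linearP !mxE ext_f // ext_g // mulr0 addr0.
have ext0 : extension 0 by move=> t j _; rewrite !linear0 mxE.
have extX i f : extension f -> extension ('X_i * f).
  move=> ext_f [|t] j lt_jt.
    by rewrite (pihomogMl_lt _ (homogX1 K i)) // !linear0 mxE.
  rewrite pihomogMl1 ?homogX1 //.
  exact: (extension_mulX i (pihomogP mdeg t f) (ext_f t) lt_jt).
split=> //.
- by move=> f g ext_f ext_g; rewrite -[f]scale1r; apply: extL.
- move=> f g ext_g; move: f; apply: mpoly_ind_vars => [|c f1 f2 e1 e2|i f ext_fg].
  + by rewrite mul1r.
  + by rewrite mulrDl -scalerAl; apply: extL.
  + by rewrite -mulrA; apply: extX.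
- move=> f t ext_f; apply/(extension_homogP (pihomogP mdeg t f)) => j.
  exact: ext_f.
Qed.

Lemma dehomog_lift t (v : 'rV[K]_(h p)) :
  (forall j : 'I_(h p), (h t <= j)%N -> v 0 j = 0) ->
  exists2 f, f \is t.-homog & phi (deh f) = v.
Proof.
move=> v_high.
(* Each [b j] is homogenized to degree [t] by a power of [z]; [j < h t] guarantees [deg j <= t], so
   the exponent is not truncated. *)
pose f := \sum_j v 0 j *: (if (j < h t)%N then z ^+ (t - deg j) * embed (b j) else 0).
exists f.
  apply: rpred_sum => j _; apply: rpredZ; case: ltnP => [lt_jt|_]; last exact: dhomog0.
  have := dhomogM (newvarX_homog K m (t - deg j)) (embed_homog (b_homog j)).
  by rewrite subnK // deg_le.
rewrite /f (linear_sum deh) (linear_sum phi) [RHS]row_sum_delta.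
apply: eq_bigr => j _; rewrite !linearZ /=.
case: ltnP => [_|/v_high ->]; last by rewrite !scale0r.
by rewrite rmorphM rmorphXn /= /dehomog eval_newvarE expr1n mul1r embedK phi_b.
Qed.

Lemma hilbert_extension : hilbert_function extension h.
Proof.
move=> t; apply/(graded_dim_coord homogeneous_extension).
have le_tp := peak_max h_incr h_decr t.
have psiL : linear (fun f => \row_(k < h t) phi (deh f) 0 (widen_ord le_tp k)).
  by move=> c f g; apply/rowP=> k; rewrite !mxE !linearP !mxE.
pose psi : {linear {mpoly K[m.+1]} -> 'rV[K]_(h t)} :=
  HB.pack (fun f => \row_(k < h t) phi (deh f) 0 (widen_ord le_tp k))
    (GRing.isLinear.Build K {mpoly K[m.+1]} 'rV[K]_(h t) _ _ psiL).
exists psi; split=> [f f_t|v].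
  apply: iff_trans (extension_homogP f_t) _; split=> [phi_f|psi_f j lt_jt].
    by apply/rowP=> k; rewrite !mxE; apply: phi_f; apply: (ltn_ord k).
  have /rowP/(_ (Ordinal lt_jt)) := psi_f; rewrite !mxE => <-.
  by congr (phi _ 0 _); apply: val_inj.
(* The vector [v] is padded with zeros from index [h t] on. *)
have [j|f f_t phi_f] := @dehomog_lift t (\row_j entry v j).
  by rewrite mxE /entry; case: insubP => // k; rewrite ltnNge => /negP.
exists f => //; apply/rowP=> k; rewrite mxE phi_f mxE /=; exact: entry_ord.
Qed.

Lemma SLP_extension : SLP extension z.
Proof.
split=> [|i s _]; first exact: newvar_homog.
have zs_homog f : f \is i.-homog -> z ^+ s * f \is (i + s).-homog.
  move=> f_i; rewrite addnC; apply: dhomogM => //.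
  exact: newvarX_homog.
(* Powers of [z] leave the coordinates unchanged; only the number of coordinates retained
   changes. *)
have deh_zs f : deh (z ^+ s * f) = deh f.
  by rewrite rmorphM rmorphXn /= /dehomog eval_newvarE expr1n mul1r.
have [le_h|/ltnW le_h] := leqP (h i) (h (i + s)); [left|right].
  move=> f g f_i g_i; rewrite /eqmod -mulrBr.
  have fg_i : f - g \is i.-homog by apply: rpredB.
  move/(extension_homogP (zs_homog _ fg_i)); rewrite deh_zs => phi_fg.
  by apply/(extension_homogP fg_i) => j /leq_trans/(_ le_h); apply: phi_fg.
move=> g g_is.
(* Truncated at [h (i + s) <= h i], the coordinates of [g] can be lifted in degree [i]. *)
pose v := \row_j (if (j < h (i + s))%N then phi (deh g) 0 j else 0).
have [j le_ij|f f_i phi_f] := @dehomog_lift i v.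
  by rewrite mxE ltnNge (leq_trans le_h le_ij).
exists f => //; have fg_homog : z ^+ s * f - g \is (i + s).-homog.
  by apply: rpredB => //; apply: zs_homog.
apply/(extension_homogP fg_homog) => j lt_j.
by rewrite !linearB /= deh_zs phi_f !mxE lt_j subrr.
Qed.

(** In degree [t], [kill] is the top part of the dehomogenization. Its coordinates have indices in
    the block of degree [t], below [h t], so the truncation does not affect them. *)
Lemma adjoin_extension f : adjoin extension z f <-> I (kill f).
Proof.
split=> [[a ext_fa]|I_f].
  have <- : kill (f - a * z) = kill f.
    by rewrite rmorphB rmorphM /= [kill z]eval_newvarE mulr0 subr0.
  apply: (ideal_homog_comp homI) => t; have g_t := pihomogP mdeg t (f - a * z).
  rewrite pihomog_kill -(proj2 (dehomog_homog g_t)).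
  apply/kerphi/rowP=> j; rewrite [RHS]mxE.
  have [eq_t|] := eqVneq t (deg j); last exact: phi_pihomog_neq.
  by have [_ _ lt_j] := degP j; rewrite {1}eq_t phi_pihomog ext_fa // eq_t.
have [a fE] := embed_kill f; exists a => t j _.
rewrite {1}fE addrK pihomog_embed [dehomog _]embedK.
by have /kerphi -> := ideal_pihomog homI t I_f; rewrite mxE.
Qed.

End Extension.

(** * Induction on the number of linear forms, and the equivalence *)

Section Main.
Variable K : fieldType.

Lemma kSLP_extension m (I : {mpoly K[m]} -> Prop) h k : homogeneous_ideal I ->
  hilbert_function I (delta h) -> unimodal h -> kSLP k I ->
  exists J : {mpoly K[m.+1]} -> Prop,
    [/\ homogeneous_ideal J, hilbert_function J h & kSLP k.+1 J].
Proof.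
move=> homI hilbI [p [h_incr h_decr]] [g slp].
have [deg [phi [b [kerphi phi_pi /all_and2[b_homog phi_b] degP]]]] :=
  graded_coordinates h_incr h_decr homI hilbI.
pose J := extension (h := h) phi.
have adjJ f : adjoin J (newvar K m) f <-> I (kill f).
  exact: (adjoin_extension homI kerphi phi_pi degP).
exists J; split.
- exact: (homogeneous_extension h_incr h_decr homI kerphi phi_pi degP).
- exact: (hilbert_extension h_incr h_decr homI kerphi phi_pi b_homog phi_b degP).
exists [tuple of newvar K m :: map (@embed K m) g] => i.
case: (unliftP ord0 i) => [i' ->|->].
  (* Dividing by the new variable first leaves a copy of $B$, where the old forms [g] already have
     the required property. *)
  rewrite tnthS tnth_map /= -map_take add_gens_cons -add_gens_adjoin.
  by apply: SLP_embed (slp i') => f; apply: add_gens_embed.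
rewrite tnth0 /= add_gens_nil.
exact: (SLP_extension h_incr b_homog phi_b degP).
Qed.

Lemma unimodal_kSLP h k :
  (forall t, (t < k)%N -> unimodal (iter t delta h)) ->
  O_sequence K (iter k delta h) ->
  exists (m : nat) (I : {mpoly K[m]} -> Prop),
    [/\ homogeneous_ideal I, hilbert_function I h & kSLP k I].
Proof.
elim: k h => [|k IHk] h unim O_h.
  have [m [I [homI hilbI]]] := O_h.
  by exists m, I; split=> //; exists [tuple] => -[].
have [t lt_tk||m [I [homI hilbI slp]]] := IHk (delta h).
- by rewrite -iterSr; apply: unim.
- by rewrite -iterSr.
by exists m.+1; apply: kSLP_extension slp => //; apply: (unim 0%N).
Qed.

(** Monomials of degree at most [c] span the quotient, since all others lie in [I]. *)
Lemma finite_artinian m (I : {mpoly K[m]} -> Prop) h c : homogeneous_ideal I ->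
  hilbert_function I h -> (forall t, (c < t)%N -> h t = 0%N) -> artinian I.
Proof.
move=> homI hilbI h_end.
pose B := 'X_{1..m < c.+1}.
exists #|{: B}|, (fun j => 'X_[(enum_val j : B)]) => f.
rewrite /eqmod (mpolyE f); elim/big_rec: _ => [|n g _ [a Ia]].
  exists (fun=> 0); rewrite big1 ?subr0; first exact: ideal0.
  by move=> j _; rewrite scale0r.
have [e Ie] : exists e : 'I_#|{: B}| -> K,
    I ('X_[n] - \sum_j e j *: 'X_[(enum_val j : B)]).
  have [le_c|lt_c] := leqP (mdeg n) c.
    have lt_nc : (mdeg n < c.+1)%N by [].
    pose j0 := enum_rank (BMultinom lt_nc : B).
    exists (fun j => (j == j0)%:R); rewrite (bigD1 j0) //= eqxx scale1r big1.
      by rewrite addr0 enum_rankK subrr; apply: ideal0.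
    by move=> j /negPf ->; rewrite scale0r.
  exists (fun=> 0); rewrite big1 ?subr0; last by move=> j _; rewrite scale0r.
  exact: hilbert_function_eq0 hilbI (h_end _ lt_c) _ (homog_monom K n).
exists (fun j => f@_n * e j + a j).
have -> : \sum_j (f@_n * e j + a j) *: 'X_[(enum_val j : B)] =
    f@_n *: (\sum_j e j *: 'X_[(enum_val j : B)]) +
    \sum_j a j *: 'X_[(enum_val j : B)] :> {mpoly K[m]}.
  by rewrite scaler_sumr -big_split; apply: eq_bigr => j _; rewrite scalerDl scalerA.
by rewrite opprD addrACA -scalerBr; apply: idealD => //; apply: idealZ.
Qed.

Lemma kSLP_kWLP m (I : {mpoly K[m]} -> Prop) k : kSLP k I -> kWLP k I.
Proof.
case=> g slp; exists g => i.
by have [g_1 full] := slp i; split=> // s; apply: full.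
Qed.
End Main.

Local Close Scope ring_scope.

Theorem proposition33 (K : fieldType) (charK0 : [pchar K]%R =i pred0)
  (n k : nat) (k_ge1 : 1 <= k) (k_le_n : k <= n)
  (c : nat) (h : nat -> nat)
  (h0 : h 0 = 1) (h1 : h 1 = n)
  (h_pos : forall j : nat, j <= c -> 0 < h j)
  (h_end : forall j : nat, c < j -> h j = 0)
  (h_Oseq : O_sequence K h) :
  [<->
    (* (i) *)
    exists (m : nat) (I : {mpoly K[m]} -> Prop),
      [/\ homogeneous_ideal I, artinian I, hilbert_function I h & kSLP k I];
    (* (ii) *)
    exists (m : nat) (I : {mpoly K[m]} -> Prop),
      [/\ homogeneous_ideal I, artinian I, hilbert_function I h & kWLP k I];
    (* (iii) *)
    [/\ unimodal h /\ O_sequence K h,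
        forall t : nat, 1 <= t -> t < k ->
          unimodal (iter t delta h) /\ O_sequence K (iter t delta h)
      & O_sequence K (iter k delta h)]].
Proof.
tfae.
- by case=> m [I [homI artI hilbI slp]]; exists m, I; split=> //; apply: kSLP_kWLP.
- case=> m [I [homI _ hilbI [g wlp]]].
  have iterP := kWLP_hilbert homI hilbI (h_end c.+1 (ltnSn c)) wlp.
  have O_iter t : t <= k -> O_sequence K (iter t delta h).
    by move=> /iterP[homJ hilbJ _]; exists m, (add_gens I (take t g)).
  have unim t : t < k -> unimodal (iter t delta h).
    move=> lt_tk; have [homJ hilbJ [s hs0]] := iterP t (ltnW lt_tk).
    exact: WLP_unimodal homJ hilbJ (wlp (Ordinal lt_tk)) hs0.
  split; last exact: O_iter.
    by split; [apply: (unim 0)|].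
  by move=> t _ lt_tk; split; [apply: unim|apply/O_iter/ltnW].
case=> [[unim_h _] unim O_k].
have [t lt_tk|m [I [homI hilbI slp]]] := @unimodal_kSLP K h k _ O_k.
  (* The case [t = 0] is the unimodality of [h] itself. *)
  by case: t lt_tk => // t lt_tk; case: (unim t.+1).
by exists m, I; split=> //; apply: finite_artinian hilbI h_end.
Qed.
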